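(* Let $A$ and $B$ be simplicial sets and let $X\to A\times B$ be a bifibration. Then $X\to A\times B$ is a trivial Kan fibration if and only if its fibers $X_{(a,b)}$, over all vertices $(a,b)$ of $A\times B$, are contractible Kan complexes.
   Context: A map $(p,q)\colon X\to A\times B$ of simplicial sets is a bifibration if: (1) $(p,q)$ is an inner fibration; (2) for every $n\geq 1$ and every commutative square with left side $\Lambda^n_0\hookrightarrow\Delta^n$, right side $(p,q)$ and bottom $f\colon\Delta^n\to A\times B$ such that $\pi_B f|\Delta^{\{0,1\}}$ is a degenerate edge of $B$, a diagonal filler exists; (3) for every $n\geq 1$ and every commutative square with left side $\Lambda^n_n\hookrightarrow\Delta^n$, right side $(p,q)$ and bottom $f$ such that $\pi_A f|\Delta^{\{n-1,n\}}$ is a degenerate edge of $A$, a diagonal filler exists. Here $\pi_A,\pi_B$ are the projections from $A\times B$. A trivial Kan fibration is a map with the right lifting property against all boundary inclusions $\partial\Delta^n\subseteq\Delta^n$, $n\ge 0$. *)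

(* Defs.v *)
From HB Require Import structures.
From mathcomp Require Import all_boot.
From mathcomp Require Import boolp.

Set Implicit Arguments.
Unset Strict Implicit.
Unset Printing Implicit Defensive.

(** * The simplex category: weakly monotone maps [m] -> [n], where the ordinal
    [n] = {0 < ... < n} is ['I_n.+1] *)

Definition monotone m n (f : {ffun 'I_m.+1 -> 'I_n.+1}) : bool :=
  [forall i : 'I_m.+1, forall j : 'I_m.+1, (i <= j) ==> (f i <= f j)].

Record mono (m n : nat) := Mono {
  mono_fun :> {ffun 'I_m.+1 -> 'I_n.+1};
  mono_monotone : monotone mono_fun }.

HB.instance Definition _ m n := [isSub for @mono_fun m n].

Lemma monoP m n (f : {ffun 'I_m.+1 -> 'I_n.+1}) :
  reflect {homo f : i j / i <= j} (monotone f).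
Proof.
apply: (iffP forallP) => [H i j ij | H i].
  by move/forallP: (H i) => /(_ j) /implyP; apply.
by apply/forallP => j; apply/implyP; apply: H.
Qed.

Lemma mono_ext m n (f g : mono m n) : f =1 g -> f = g.
Proof. by move=> fg; apply/val_inj/ffunP. Qed.

Lemma mono_of_subproof m n (f : 'I_m.+1 -> 'I_n.+1) :
  {homo f : i j / i <= j} -> monotone (finfun f).
Proof. by move=> H; apply/monoP => i j ij; rewrite !ffunE; apply: H. Qed.

Definition mono_of m n (f : 'I_m.+1 -> 'I_n.+1)
    (H : {homo f : i j / i <= j}) : mono m n :=
  Mono (mono_of_subproof H).

Lemma mono_ofE m n (f : 'I_m.+1 -> 'I_n.+1) (H : {homo f : i j / i <= j}) i :
  mono_of H i = f i.
Proof. by rewrite ffunE. Qed.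

Definition mono_id n : mono n n := @mono_of n n id (fun _ _ ij => ij).

Lemma mono_comp_subproof l m n (g : mono m n) (f : mono l m) :
  {homo (fun i => g (f i)) : i j / i <= j}.
Proof. by move=> i j ij; do 2! apply: (monoP _ (mono_monotone _)). Qed.

Definition mono_comp l m n (g : mono m n) (f : mono l m) : mono l n :=
  mono_of (mono_comp_subproof g f).

Lemma mono_idE n i : mono_id n i = i.
Proof. exact: mono_ofE. Qed.

Lemma mono_compE l m n (g : mono m n) (f : mono l m) i :
  mono_comp g f i = g (f i).
Proof. exact: mono_ofE. Qed.

Lemma mono_comp_idl m n (f : mono m n) : mono_comp (mono_id n) f = f.
Proof. by apply: mono_ext => i; rewrite mono_compE mono_idE. Qed.

Lemma mono_comp_idr m n (f : mono m n) : mono_comp f (mono_id m) = f.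
Proof. by apply: mono_ext => i; rewrite mono_compE mono_idE. Qed.

Lemma mono_compA k l m n (h : mono m n) (g : mono l m) (f : mono k l) :
  mono_comp h (mono_comp g f) = mono_comp (mono_comp h g) f.
Proof. by apply: mono_ext => i; rewrite !mono_compE. Qed.

Lemma mono_const_subproof m n (j : 'I_n.+1) :
  {homo (fun _ : 'I_m.+1 => j) : i k / i <= k}.
Proof. by []. Qed.

Definition mono_const m n (j : 'I_n.+1) : mono m n :=
  mono_of (@mono_const_subproof m n j).

(** * Simplicial sets and simplicial maps *)

Record sSet := SSet {
  simplex :> nat -> Type;
  act : forall m n, mono m n -> simplex n -> simplex m;
  act_id : forall n (x : simplex n), act (mono_id n) x = x;
  act_comp : forall l m n (g : mono m n) (f : mono l m) (x : simplex n),
    act (mono_comp g f) x = act f (act g x) }.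

Arguments act {_ m n} _ _.

Record smap (X Y : sSet) := SMap {
  smap_fun :> forall n, X n -> Y n;
  smap_nat : forall m n (f : mono m n) (x : X n),
    smap_fun (act f x) = act f (smap_fun x) }.

Arguments smap_fun {X Y} _ {n} _.

Lemma smap_ext (X Y : sSet) (f g : smap X Y) :
  (forall n (x : X n), f n x = g n x) -> f = g.
Proof.
case: f g => [f Hf] [g Hg] /= fg.
have E : f = g by apply: functional_extensionality_dep => n; apply/funext.
by case: _ / E Hg => Hg; rewrite (Prop_irrelevance Hf Hg).
Qed.

Definition sid (X : sSet) : smap X X :=
  @SMap X X (fun _ x => x) (fun _ _ _ _ => erefl).

Lemma scomp_subproof (X Y Z : sSet) (g : smap Y Z) (f : smap X Y)
    m n (s : mono m n) (x : X n) :
  g m (f m (act s x)) = act s (g n (f n x)).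
Proof. by rewrite !smap_nat. Qed.

Definition scomp (X Y Z : sSet) (g : smap Y Z) (f : smap X Y) : smap X Z :=
  SMap (scomp_subproof g f).

(** [x] is [s^*y] for a simplex [y] of smaller dimension; for an edge this says
    [x = s_0 y] with [y] a vertex *)
Definition degenerate (X : sSet) n (x : X n) : Prop :=
  exists m (s : mono n m) (y : X m), m < n /\ x = act s y.

(** * Products *)

Lemma sprod_act_id (A B : sSet) n (x : A n * B n) :
  (act (mono_id n) x.1, act (mono_id n) x.2) = x.
Proof. by case: x => a b; rewrite !act_id. Qed.

Lemma sprod_act_comp (A B : sSet) l m n (g : mono m n) (f : mono l m)
    (x : A n * B n) :
  (act (mono_comp g f) x.1, act (mono_comp g f) x.2)
  = (act f (act g x.1), act f (act g x.2)).
Proof. by rewrite !act_comp. Qed.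

Definition sprod (A B : sSet) : sSet :=
  @SSet (fun n => (A n * B n)%type)
    (fun m n f x => (act f x.1, act f x.2))
    (@sprod_act_id A B) (@sprod_act_comp A B).

Definition sfst (A B : sSet) : smap (sprod A B) A :=
  @SMap (sprod A B) A (fun _ x => x.1) (fun _ _ _ _ => erefl).

Definition ssnd (A B : sSet) : smap (sprod A B) B :=
  @SMap (sprod A B) B (fun _ x => x.2) (fun _ _ _ _ => erefl).

(** * Simplicial subsets *)

Record subsSet (X : sSet) := SubsSet {
  sub_mem : forall n, X n -> Prop;
  sub_act : forall m n (f : mono m n) (x : X n),
    sub_mem x -> sub_mem (act f x) }.

Lemma sub_eq (X : sSet) (S : subsSet X) n
    (x y : {x : X n | sub_mem S x}) : sval x = sval y -> x = y.
Proof. by case: x y => [x Hx] [y Hy] /= E; apply: eq_exist. Qed.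

Definition sub_act_fun (X : sSet) (S : subsSet X) m n (f : mono m n)
    (x : {x : X n | sub_mem S x}) : {x : X m | sub_mem S x} :=
  exist _ (act f (sval x)) (sub_act f (svalP x)).

Lemma sub_act_id (X : sSet) (S : subsSet X) n (x : {x : X n | sub_mem S x}) :
  sub_act_fun (mono_id n) x = x.
Proof. by apply: sub_eq; rewrite /= act_id. Qed.

Lemma sub_act_comp (X : sSet) (S : subsSet X) l m n (g : mono m n)
    (f : mono l m) (x : {x : X n | sub_mem S x}) :
  sub_act_fun (mono_comp g f) x = sub_act_fun f (sub_act_fun g x).
Proof. by apply: sub_eq; rewrite /= act_comp. Qed.

Definition sub_sSet (X : sSet) (S : subsSet X) : sSet :=
  SSet (@sub_act_id X S) (@sub_act_comp X S).

Coercion sub_sSet : subsSet >-> sSet.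

Definition sub_incl (X : sSet) (S : subsSet X) : smap S X :=
  @SMap S X (fun _ x => sval x) (fun _ _ _ _ => erefl).

(** * Standard simplices, boundaries and horns *)

Definition Delta (n : nat) : sSet :=
  @SSet (fun m => mono m n) (fun _ _ f x => mono_comp x f)
    (fun _ x => mono_comp_idr x) (fun _ _ _ g f x => mono_compA x g f).

(** [j] is not a value of the simplex [x] of [Delta n]; equivalently, [x] lies in
    the face opposite to [j] *)
Definition misses n m (x : Delta n m) (j : 'I_n.+1) : Prop :=
  forall i, (x : mono m n) i <> j.

Lemma misses_act n l m (f : mono l m) (x : Delta n m) j :
  misses x j -> misses (act f x) j.
Proof. by move=> H i; rewrite /= mono_compE; apply: H. Qed.

Lemma boundary_act n l m (f : mono l m) (x : Delta n m) :
  (exists j, misses x j) -> exists j, misses (act f x) j.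
Proof. by case=> j H; exists j; apply: misses_act. Qed.

Definition boundary (n : nat) : subsSet (Delta n) :=
  SubsSet (@boundary_act n).

Lemma horn_act n (k : 'I_n.+1) l m (f : mono l m) (x : Delta n m) :
  (exists2 j, j <> k & misses x j) -> exists2 j, j <> k & misses (act f x) j.
Proof. by case=> j jk H; exists j => //; apply: misses_act. Qed.

Definition horn (n : nat) (k : 'I_n.+1) : subsSet (Delta n) :=
  SubsSet (@horn_act n k).

(** The edges Delta^{0,1} and Delta^{n,n+1} of Delta^(n+1), as 1-simplices *)
Lemma first_edge_subproof n :
  {homo (fun i : 'I_2 => inord i : 'I_n.+2) : i j / i <= j}.
Proof.
have lt2 (k : 'I_2) : k < n.+2 by apply: leq_trans (ltn_ord k) _.
by move=> i j ij; rewrite !inordK.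
Qed.

Definition first_edge n : Delta n.+1 1 := mono_of (@first_edge_subproof n).

Lemma last_edge_subproof n :
  {homo (fun i : 'I_2 => inord (n + i) : 'I_n.+2) : i j / i <= j}.
Proof.
have lt2 (k : 'I_2) : n + k < n.+2 by have := ltn_ord k; rewrite -(ltn_add2l n) addn2.
by move=> i j ij; rewrite !inordK // leq_add2l.
Qed.

Definition last_edge n : Delta n.+1 1 := mono_of (@last_edge_subproof n).

(** * Lifting properties *)

Definition commutes (K L X Y : sSet) (i : smap K L) (p : smap X Y)
    (u : smap K X) (v : smap L Y) : Prop :=
  scomp p u = scomp v i.

Definition has_filler (K L X Y : sSet) (i : smap K L) (p : smap X Y)
    (u : smap K X) (v : smap L Y) : Prop :=
  exists h : smap L X, scomp h i = u /\ scomp p h = v.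

Definition rlp (K L X Y : sSet) (i : smap K L) (p : smap X Y) : Prop :=
  forall (u : smap K X) (v : smap L Y), commutes i p u v -> has_filler i p u v.

Definition inner_fibration (X Y : sSet) (p : smap X Y) : Prop :=
  forall n (k : 'I_n.+1), 0 < k < n -> rlp (sub_incl (horn k)) p.

Definition trivial_Kan_fibration (X Y : sSet) (p : smap X Y) : Prop :=
  forall n, rlp (sub_incl (boundary n)) p.

(** Dimensions [n >= 1] are written [n.+1]. *)
Definition bifibration (X A B : sSet) (p : smap X (sprod A B)) : Prop :=
  [/\ inner_fibration p,
      forall n (u : smap (horn (ord0 : 'I_n.+2)) X)
          (f : smap (Delta n.+1) (sprod A B)),
        commutes (sub_incl (horn ord0)) p u f ->
        degenerate (scomp (ssnd A B) f 1 (first_edge n)) ->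
        has_filler (sub_incl (horn ord0)) p u f
    & forall n (u : smap (horn (ord_max : 'I_n.+2)) X)
          (f : smap (Delta n.+1) (sprod A B)),
        commutes (sub_incl (horn ord_max)) p u f ->
        degenerate (scomp (sfst A B) f 1 (last_edge n)) ->
        has_filler (sub_incl (horn ord_max)) p u f].

(** * Fibres *)

(** [mono_const n ord0] is the unique map [n] -> [0], so the fibre over a vertex
    [y] consists of the simplices lying over the degeneracies of [y]: it is the
    pullback of [p] along [y : Delta 0 -> Y]. *)
Lemma fiber_act (X Y : sSet) (p : smap X Y) (y : Y 0) m n (f : mono m n)
    (x : X n) :
  p n x = act (mono_const n ord0) y ->
  p m (act f x) = act (mono_const m ord0) y.
Proof.
move=> E; rewrite smap_nat E -act_comp; congr (act _ y).
by apply: mono_ext => i; rewrite mono_compE !mono_ofE.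
Qed.

Definition fiber (X Y : sSet) (p : smap X Y) (y : Y 0) : subsSet X :=
  SubsSet (@fiber_act X Y p y).

(** * Contractible Kan complexes *)

Definition Kan_complex (X : sSet) : Prop :=
  forall n (k : 'I_n.+1), 0 < n ->
  forall u : smap (horn k) X,
  exists h : smap (Delta n) X, scomp h (sub_incl (horn k)) = u.

(** One-step simplicial homotopy; between maps into a Kan complex this relation
    is already an equivalence relation. *)
Definition homotopic (X Y : sSet) (f g : smap X Y) : Prop :=
  exists H : smap (sprod X (Delta 1)) Y,
    (forall n (x : X n), H n (x, mono_const n ord0) = f n x) /\
    (forall n (x : X n), H n (x, mono_const n ord_max) = g n x).

Definition homotopy_equivalence (X Y : sSet) (f : smap X Y) : Prop :=
  exists g : smap Y X,
    homotopic (scomp g f) (sid X) /\ homotopic (scomp f g) (sid Y).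

Lemma to_point_subproof (X : sSet) m n (f : mono m n) (x : X n) :
  (mono_const m ord0 : Delta 0 m) = act f (mono_const n ord0 : Delta 0 n).
Proof. by apply: mono_ext => i; rewrite [RHS]mono_compE !mono_ofE. Qed.

Definition to_point (X : sSet) : smap X (Delta 0) :=
  @SMap X (Delta 0) (fun n _ => mono_const n ord0) (@to_point_subproof X).

Definition contractible_Kan_complex (X : sSet) : Prop :=
  Kan_complex X /\ homotopy_equivalence (to_point X).

(* Main.v *)
Require Import Defs.
From mathcomp Require Import all_boot.
From mathcomp Require Import boolp zify.
From mathcomp Require classical_sets.

(** A trivial Kan fibration extends every partial lift (Zorn, attaching one
    simplex at a time: [extend_total]); applied to a fibre over a point this
    fills horns and contracts the fibre ([contractible_of_fills]).

    For the converse, a lifting problem for the boundary of Delta^n over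
    f = (a, b) : Delta^n -> A x B is a sequence of pairs of vertices
    (a_0, b_0), ..., (a_n, b_n), and it is moved step by step until it lies in a
    single fibre.  Between (a_k, b_k) and (a_{k+1}, b_{k+1}) insert the vertex
    e = (a_{k+1}, b_k); this is an (n+1)-simplex s of A x B whose face opposite
    to e is f.  The edge from (a_k, b_k) to e is degenerate in B, so every horn
    at the vertex k of a face of s that contains k and e is either inner or a
    left horn of the kind that a bifibration fills.  Filling these horns in
    order of dimension extends a partial lift from the boundary of f to all
    proper faces of s that are needed to pose the boundary problem on the face
    opposite to k; solving that one and then filling the inner horn at e solves
    the problem for f ([pivot]).  The face opposite to k is f with a_k replaced by
    a_{k+1} ([raise_vertex]).  Dually, the right horns at the vertex after e
    replace b_{k+1} by b_k ([lower_vertex]).  Repeating both, it suffices to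
    solve the problem over the constant simplex (a_n, b_0), that is in the fibre
    over that vertex ([fiber_fills]).  There, a boundary in a contractible Kan
    complex is the end of a null-homotopy on the boundary times Delta^1, which
    extends over the prism Delta^n x Delta^1 by filling n+1 horns
    ([fills_of_contractible]).

    All extension steps are carried out on functional relations between a
    simplicial set L and X ([partial_lift]), so that adding a simplex or taking
    a union does not require a quotient or a choice of representatives. *)

Set Implicit Arguments.
Unset Strict Implicit.
Unset Printing Implicit Defensive.


(** * Monotone maps *)

Lemma mono_nat_ext m n (f g : mono m n) :
  (forall i, f i = g i :> nat) -> f = g.
Proof. by move=> fg; apply: mono_ext => i; apply: val_inj; apply: fg. Qed.

Lemma mono_le m n (f : mono m n) (i j : 'I_m.+1) : i <= j -> f i <= f j.
Proof. exact: (monoP _ (mono_monotone f)). Qed.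

Lemma mono_inj_le m n (f : mono m n) (i j : 'I_m.+1) :
  injective f -> f i <= f j -> i <= j.
Proof.
move=> fI le_f; rewrite leqNgt; apply/negP => ltji.
have /fI E : f i = f j.
  by apply/val_inj/eqP; rewrite eqn_leq le_f mono_le // ltnW.
by rewrite E ltnn in ltji.
Qed.

(** The values are cut off at [n], so that a formula on [nat] need not be bounded
    to define a monotone map. *)
Definition mono_nat m n (f : nat -> nat) (H : {homo f : i j / i <= j}) :
  mono m n.
Proof.
refine (@mono_of m n (fun i => inord (minn n (f i))) _) => i j ij.
have lt_min k : minn n (f k) < n.+1 by lia.
by rewrite !inordK //; move: (H _ _ ij); lia.
Defined.

Lemma mono_natE m n f (H : {homo f : i j / i <= j}) (i : 'I_m.+1) :
  mono_nat m n H i = minn n (f i) :> nat.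
Proof. by rewrite mono_ofE inordK; lia. Qed.

Lemma face_homo n (i : 'I_n.+2) :
  {homo (fun j : 'I_n.+1 => lift i j) : j k / j <= k}.
Proof. by move=> j k jk /=; rewrite /bump; lia. Qed.

Definition face n (i : 'I_n.+2) : mono n n.+1 := mono_of (@face_homo n i).

Lemma faceE n (i : 'I_n.+2) j : face i j = lift i j.
Proof. exact: mono_ofE. Qed.

Lemma face_inj n (i : 'I_n.+2) : injective (face i).
Proof. by move=> j k; rewrite !faceE; apply: lift_inj. Qed.

Lemma face_misses n (i : 'I_n.+2) : misses (face i : Delta n.+1 n) i.
Proof. by move=> j; rewrite faceE; apply/eqP; rewrite eq_sym neq_lift. Qed.

Lemma surjP m n (f : mono m n) :
  (exists j, misses (f : Delta n m) j) \/ (forall j, exists i, f i = j).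
Proof.
case: (EM (exists j, misses (f : Delta n m) j)); first by left.
move=> Nf; right=> j; apply: contrapT => Nj; apply: Nf; exists j => i fij.
by apply: Nj; exists i.
Qed.

Lemma mono_factor m n l (x : mono n l) (z : mono m l) :
  injective x -> (forall i, exists j, x j = z i) ->
  exists g, z = mono_comp x g.
Proof.
move=> xI xz; have /choice[g gE] := xz.
have gM : {homo g : i j / i <= j}.
  by move=> i j ij; apply: (mono_inj_le xI); rewrite !gE mono_le.
by exists (mono_of gM); apply: mono_ext => i; rewrite mono_compE mono_ofE gE.
Qed.

Lemma face_factor m n (i : 'I_n.+2) (z : mono m n.+1) :
  misses (z : Delta n.+1 m) i -> exists g, z = mono_comp (face i) g.
Proof.
move=> zi; apply: mono_factor; first exact: face_inj.
move=> j; case: (unliftP i (z j)) => [k|] E; last by case: (zi j).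
by exists k; rewrite faceE.
Qed.

(** Any set-theoretic section of a monotone surjection is monotone, so one can be
    chosen through a prescribed point; this is what separates two distinct
    surjections in [attach_cell]. *)
Lemma mono_section m n (f : mono m n) (l : 'I_m.+1) :
  (forall j, exists i, f i = j) ->
  exists s, mono_comp f s = mono_id n /\ s (f l) = l.
Proof.
move=> /choice[s0 s0E].
pose s j := if j == f l then l else s0 j.
have sE j : f (s j) = j by rewrite /s; case: eqP => // ->.
have sM : {homo s : i j / i <= j}.
  move=> i j; rewrite leq_eqVlt => /orP[/eqP/val_inj->//|lt_ij].
  rewrite leqNgt; apply/negP => /ltnW/(mono_le f); rewrite !sE; lia.
exists (mono_of sM); split; last by rewrite mono_ofE /s eqxx.
by apply: mono_ext => i; rewrite mono_compE mono_ofE mono_idE sE.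
Qed.

Lemma mono_inj_ge m n (f : mono m n) (i : 'I_m.+1) : injective f -> i <= f i.
Proof.
move=> fI; case: i => i; elim: i => [//|i IH] Hi.
have Hi' : i < m.+1 by lia.
have := IH Hi'; suff : f (Ordinal Hi') < f (Ordinal Hi) by move=> /=; lia.
rewrite ltnNge; apply/negP => /(mono_inj_le fI) /=; lia.
Qed.

(** A surjection is bijective here, hence strictly increasing, as is its section;
    an increasing injection dominates the identity, so both equal it. *)
Lemma mono_surj_id n (f : mono n n) :
  (forall j, exists i, f i = j) -> f = mono_id n.
Proof.
move=> fS; have [s [fs _]] := mono_section ord0 fS.
have fsE i : f (s i) = i by rewrite -mono_compE fs mono_idE.
have sI : injective s by move=> i j /(congr1 f); rewrite !fsE.
have [s' ss' s's] := injF_bij sI.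
have fI : injective f.
  by move=> i j; rewrite -[i]s's -[j]s's !fsE => ->.
apply: mono_ext => i; apply/val_inj/eqP; rewrite mono_idE eqn_leq /=.
rewrite mono_inj_ge // andbT -[leqRHS](congr1 val (fsE i)).
exact/mono_le/mono_inj_ge.
Qed.

(** If [F] is not everything it lies in a face, and the simplex is found there. *)
Lemma subset_simplex l (F : {set 'I_l.+1}) : F != set0 ->
  exists m (x : mono m l), injective x /\ forall i, i \in F <-> exists j, x j = i.
Proof.
elim: l F => [|l IH] F /set0Pn[i0 Fi0].
  exists 0, (mono_id 0); split=> [i j|i]; first by rewrite !ord1.
  by rewrite ord1 -(ord1 i0) Fi0; split=> // _; exists ord0; rewrite !ord1.
have [FT|] := eqVneq F setT.
  exists l.+1, (mono_id _); split=> [i j|i]; first by rewrite !mono_idE.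
  by rewrite FT inE; split=> // _; exists i; rewrite mono_idE.
rewrite -subTset => /subsetPn[i _ NFi].
have i0E : exists k, i0 = lift i k.
  by case: (unliftP i i0) Fi0 => [k|] -> Fi0; [exists k | rewrite Fi0 in NFi].
case: i0E Fi0 => k -> Fk.
have [|m [x [xI xE]]] := IH [set k | lift i k \in F].
  by apply/set0Pn; exists k; rewrite inE.
exists m, (mono_comp (face i) x); split.
  by move=> a b; rewrite !mono_compE => /face_inj /xI.
move=> j; split.
  case: (unliftP i j) => [k' ->|->] Fj; last by rewrite Fj in NFi.
  have /xE[a aE] : k' \in [set k | lift i k \in F] by rewrite inE.
  by exists a; rewrite mono_compE faceE aE.
case=> a; rewrite mono_compE faceE => <-.
by have := (xE (x a)).2 (ex_intro _ a erefl); rewrite inE.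
Qed.

(** * Partial lifts and the attachment of simplices *)

Section PartialLifts.
Variables (X Y L : sSet) (p : smap X Y) (v : smap L Y).

Record partial_lift := PartialLift {
  graph :> forall n, L n -> X n -> Prop;
  graph_act : forall m n (f : mono m n) z w,
    graph z w -> graph (act f z) (act f w);
  graph_functional : forall n (z : L n) w w', graph z w -> graph z w' -> w = w';
  graph_over : forall n (z : L n) w, graph z w -> p n w = v n z }.

Definition dom (G : partial_lift) n (z : L n) : Prop := exists w, G n z w.

Definition extends (G H : partial_lift) : Prop :=
  forall n (z : L n) w, G n z w -> H n z w.

Lemma extends_trans G H K : extends G H -> extends H K -> extends G K.
Proof. by move=> GH HK n z w /GH/HK. Qed.

Lemma dom_act G m n (f : mono m n) z : dom G z -> dom G (act f z).
Proof. by case=> w Gzw; exists (act f w); apply: graph_act. Qed.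

Definition generated (G : partial_lift) n (x : L n) (y : X n) m z w : Prop :=
  G m z w \/ exists f : mono m n, z = act f x /\ w = act f y.

(** If all proper faces of [x] are in the domain but [x] is not, then [x] is
    nondegenerate relative to [G], and the only new simplices are [act f x] with
    [f] surjective.  For these [f] is determined by [act f x]: if [f l] differs
    from [g l], a section [s] of [f] through [l] gives
    [x = act (mono_comp g s) x] with [mono_comp g s] not the identity, hence not
    surjective, and [x] would be in the domain. *)
Lemma attach_cell (G : partial_lift) n (x : L n) (y : X n) :
  p n y = v n x -> ~ dom G x ->
  (forall m (f : mono m n), (exists j, misses (f : Delta n m) j) ->
     G m (act f x) (act f y)) ->
  exists2 H, extends G H & forall m z w, H m z w <-> generated G x y z w.
Proof.
move=> py Nx bd.
have surj m (f : mono m n) :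
    dom G (act f x) -> exists j, misses (f : Delta n m) j.
  move=> Dfx; case: (surjP f) => // fS; case: Nx.
  have [s [fs _]] := mono_section ord0 fS.
  by rewrite -[x]act_id -fs act_comp; apply: dom_act.
have gen_act l m (f : mono l m) z w :
    generated G x y z w -> generated G x y (act f z) (act f w).
  case=> [Gzw|[g [-> ->]]]; first by left; apply: graph_act.
  by right; exists (mono_comp g f); rewrite !act_comp.
have gen_over m z w : generated G x y z w -> p m w = v m z.
  by case=> [/graph_over//|[g [-> ->]]]; rewrite !smap_nat py.
have gen_fun m z w w' :
    generated G x y z w -> generated G x y z w' -> w = w' :> X m.
  case=> [Gzw|[f [zE ->]]] [Gzw'|[g [zE' ->]]].
  - exact: graph_functional Gzw Gzw'.
  - have /surj/bd : dom G (act g x) by rewrite -zE'; exists w.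
    by rewrite -zE'; apply: graph_functional.
  - have /surj/bd : dom G (act f x) by rewrite -zE; exists w'.
    by rewrite -zE => Gz; apply: graph_functional Gz Gzw'.
  have fgx : act f x = act g x by rewrite -zE.
  case: (surjP f) => [/[dup] Nf /bd Gf|fS].
    have /surj/bd : dom G (act g x) by rewrite -fgx; exists (act f y).
    by rewrite -fgx; apply: graph_functional.
  case: (surjP g) => [/bd Gg|gS].
    have /surj/bd : dom G (act f x) by rewrite fgx; exists (act g y).
    by rewrite fgx => Gf; apply: graph_functional Gf Gg.
  suff -> : f = g by [].
  apply: contrapT => nfg; apply: Nx.
  have [l nfgl] : exists l, f l <> g l.
    by apply: contrapT => E; apply/nfg/mono_ext => l; apply: contrapT => ?;
       apply: E; exists l.
  have [s [fs sl]] := mono_section l fS.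
  have xE : x = act (mono_comp g s) x by rewrite act_comp -fgx -act_comp fs act_id.
  case: (surjP (mono_comp g s)) => [/bd Gx|/mono_surj_id gs].
    by rewrite xE; exists (act (mono_comp g s) y).
  by case: nfgl; rewrite -[LHS]mono_idE -gs mono_compE sl.
exists (PartialLift gen_act gen_fun gen_over) => //.
by move=> m z w; left.
Qed.

(** The map from the standard simplex classified by [x] is injective. *)
Definition embedded n (x : L n) : Prop :=
  forall m, injective (fun f : mono m n => act f x).

(** Two cells are attached: the missing face of the horn, then its interior. *)
Lemma attach_horn (G : partial_lift) n (x : L n.+1) (y : X n.+1) (i : 'I_n.+2) :
  p n.+1 y = v n.+1 x -> embedded x -> ~ dom G (act (face i) x) ->
  (forall m (f : mono m n.+1), (exists2 j, j <> i & misses (f : Delta n.+1 m) j) ->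
     G m (act f x) (act f y)) ->
  exists2 H, extends G H & forall m z w, H m z w <-> generated G x y z w.
Proof.
move=> py xI Nx bd.
have [||m f [j fj]|G1 GG1 G1E] := @attach_cell G _ (act (face i) x) (act (face i) y).
- by rewrite !smap_nat py.
- by [].
- rewrite -!act_comp; apply: bd; exists (lift i j).
    by apply/eqP; rewrite eq_sym neq_lift.
  by move=> k; rewrite mono_compE faceE => /lift_inj; apply: fj.
have [||m f [j fj]|H G1H HE] := @attach_cell G1 _ x y; first by [].
- case=> w /G1E[Gxw|[f [xE _]]].
    by apply: Nx; exists (act (face i) w); apply: graph_act.
  have /xI/(congr1 (fun g : mono _ _ => g i)) : act (mono_id _) x =
      act (mono_comp (face i) f) x by rewrite act_id act_comp.
  by rewrite mono_idE mono_compE => /esym/face_misses.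
- apply/G1E; have [ij|/eqP ji] := eqVneq j i; last by left; apply: bd; exists j.
  have [|g ->] := @face_factor _ _ i f; first by rewrite -ij.
  by right; exists g; rewrite !act_comp.
exists H; first exact: extends_trans GG1 G1H.
move=> m z w; rewrite HE; split; last by case=> [/GG1|] ?; [left|right].
case=> [/G1E[|[f [-> ->]]]|]; [by left| |by right].
by right; exists (mono_comp (face i) f); rewrite !act_comp.
Qed.

Lemma smap_of_dom (M : sSet) (j : smap M L) (G : partial_lift) :
  (forall n (z : M n), dom G (j n z)) ->
  exists u : smap M X, forall n (z : M n), G n (j n z) (u n z).
Proof.
move=> MG; have ch n (z : M n) := cid (MG n z).
unshelve eexists (@SMap M X (fun n z => sval (ch n z)) _) => [m n f z|n z] /=.
  apply: graph_functional (svalP (ch m (act f z))) _.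
  by rewrite smap_nat; apply: graph_act (svalP (ch n z)).
exact: svalP (ch n z).
Qed.

Section OfSub.
Variables (S : subsSet L) (u : smap S X).
Hypothesis u_over : forall n (z : S n), p n (u n z) = v n (sval z).

Definition sub_graph n (z : L n) (w : X n) : Prop :=
  exists Hz : Defs.sub_mem S z, w = u n (exist _ z Hz).

Lemma sub_graph_act m n (f : mono m n) z w :
  sub_graph z w -> sub_graph (act f z) (act f w).
Proof.
case=> Hz ->; exists (sub_act f Hz); rewrite -smap_nat; congr (u m _).
exact: sub_eq.
Qed.

Lemma sub_graph_functional n (z : L n) w w' :
  sub_graph z w -> sub_graph z w' -> w = w'.
Proof. by case=> Hz -> [Hz' ->]; congr (u n _); apply: sub_eq. Qed.

Lemma sub_graph_over n (z : L n) w : sub_graph z w -> p n w = v n z.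
Proof. by case=> Hz ->; rewrite u_over. Qed.

Definition lift_of_sub : partial_lift :=
  PartialLift sub_graph_act sub_graph_functional sub_graph_over.

Lemma lift_of_subP n (z : S n) : lift_of_sub n (sval z) (u n z).
Proof. by exists (svalP z); congr (u n _); apply: sub_eq. Qed.

End OfSub.
End PartialLifts.

Definition yoneda (Y : sSet) n (y : Y n) : smap (Delta n) Y.
Proof.
by refine (@SMap (Delta n) Y (fun m (z : Delta n m) => act (z : mono m n) y) _)
  => l m f z /=; rewrite act_comp.
Defined.

Lemma yoneda_id (Y : sSet) n (f : smap (Delta n) Y) m (z : Delta n m) :
  f m z = act (z : mono m n) (f n (mono_id n)).
Proof. by rewrite -smap_nat /= mono_comp_idl. Qed.

Section Fill.
Variables (X Y : sSet) (p : smap X Y).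

(** Lifting against the inclusion of [S] over the map classified by [y], with the
    filler given as a simplex. *)
Definition fills n (S : subsSet (Delta n)) (y : Y n) : Prop :=
  forall u : smap S X,
    (forall m (z : S m), p m (u m z) = act (sval z : mono m n) y) ->
  exists2 x, p n x = y & forall m (z : S m), u m z = act (sval z : mono m n) x.

(** By the Yoneda lemma a square over a map from the standard simplex is the same
    as a square over its value on the identity. *)
Lemma filler_fills n (S : subsSet (Delta n)) (f : smap (Delta n) Y) :
  (forall u, commutes (sub_incl S) p u f -> has_filler (sub_incl S) p u f)
  <-> fills S (f n (mono_id n)).
Proof.
split=> H u.
  move=> pu; have [|h [hu hf]] := H u.
    by apply: smap_ext => m z /=; rewrite pu -yoneda_id.
  exists (h n (mono_id n)); first by rewrite -hf.
  by move=> m z; rewrite -hu /= yoneda_id.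
move=> pu; have [|x px ux] := H u.
  by move=> m z; rewrite -yoneda_id -[RHS]/(scomp f (sub_incl S) m z) -pu.
exists (yoneda x); split; apply: smap_ext => m z /=; first by rewrite ux.
by rewrite smap_nat px -yoneda_id.
Qed.

(** The form in which fillers are used: [G] supplies the partial section on [S]. *)
Lemma fills_graph n (S : subsSet (Delta n)) (y : Y n)
    (G : partial_lift p (yoneda y)) :
  fills S y -> (forall m (z : Delta n m), Defs.sub_mem S z -> dom G z) ->
  exists2 x, p n x = y &
    forall m (z : Delta n m), Defs.sub_mem S z -> G m z (act (z : mono m n) x).
Proof.
move=> fS SG; have [|u uG] := @smap_of_dom _ _ _ _ _ _ (sub_incl S) G.
  by move=> m z; apply: SG (svalP z).
have [m z|x px ux] := fS u; first exact: graph_over (uG m z).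
by exists x => // m z Sz; rewrite -(ux m (exist _ z Sz)); exact: (uG m (exist _ z Sz)).
Qed.

End Fill.

Section Pullback.
Variables (X Y L : sSet) (p : smap X Y) (v : smap L Y).
Variables (G : partial_lift p v) (m : nat) (x : L m).

Definition pullback_lift : partial_lift p (yoneda (v m x)).
Proof.
refine (@PartialLift _ _ _ p (yoneda (v m x))
  (fun l (z : Delta m l) w => G l (act (z : mono l m) x) w) _ _ _).
- by move=> k l f z w /= Gz; rewrite act_comp; apply: graph_act.
- by move=> l z w w' /=; apply: graph_functional.
- by move=> l z w /= /graph_over ->; rewrite smap_nat.
Defined.

End Pullback.

(** * Extension along arbitrary inclusions *)

Section Extension.
Variables (X Y L : sSet) (p : smap X Y) (v : smap L Y).
Variable (G : partial_lift p v).

Lemma chain_bound (A : {H : partial_lift p v | extends G H} -> Prop) :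
  (forall H K, A H -> A K -> extends (sval H) (sval K) \/ extends (sval K) (sval H)) ->
  exists K : {H : partial_lift p v | extends G H},
    forall H, A H -> extends (sval H) (sval K).
Proof.
move=> Atot.
pose U n z w := G n z w \/ exists2 H, A H & sval H n z w.
have U_act m n (f : mono m n) z w : U n z w -> U m (act f z) (act f w).
  case=> [Gz|[H AH Hz]]; first by left; apply: graph_act.
  by right; exists H => //; apply: graph_act.
have U_over n z w : U n z w -> p n w = v n z.
  by case=> [/graph_over//|[H _ /graph_over]].
have U_fun n z w w' : U n z w -> U n z w' -> w = w'.
  case=> [Gz|[H AH Hz]] [Gz'|[K AK Kz']].
  - exact: graph_functional Gz Gz'.
  - exact: graph_functional (svalP K _ _ _ Gz) Kz'.
  - exact: graph_functional Hz (svalP H _ _ _ Gz').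
  - case: (Atot _ _ AH AK) => [/(_ _ _ _ Hz) Kz|/(_ _ _ _ Kz') Hz'].
      exact: graph_functional Kz Kz'.
    exact: graph_functional Hz Hz'.
have GU : extends G (PartialLift U_act U_fun U_over) by move=> n z w; left.
by exists (exist _ _ GU) => H AH n z w Hz; right; exists H.
Qed.

(** In a maximal extension a simplex of least dimension outside the domain has its
    whole boundary in the domain, and could be attached. *)
Lemma extend_total : (forall n y, fills p (boundary n) y) ->
  exists2 H, extends G H & forall n (z : L n), dom H z.
Proof.
move=> bd; pose T := {H : partial_lift p v | extends G H}.
pose R (H K : T) := `[< extends (sval H) (sval K) >].
have GG : extends G G by [].
have [|r s t|A Atot|[H GH] Hmax] := @classical_sets.ZL_preorder T (exist _ G GG) R.
- by move=> H; apply/asboolP.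
- by move=> /asboolP rs /asboolP st; apply/asboolP; apply: extends_trans rs st.
- have [|K AK] := @chain_bound A; last by exists K => H AH; apply/asboolP/AK.
  by move=> H K AH AK; case: (Atot _ _ AH AK) => /asboolP; [left|right].
exists H => //; elim/ltn_ind => n IH z; apply: contrapT => Nz.
have bdz m (f : Delta n m) : Defs.sub_mem (boundary n) f -> dom (pullback_lift H z) f.
  case=> j fj; case: n => [|n] in IH z Nz f j fj *.
    by case: (fj ord0); rewrite !ord1.
  have [g ->] := face_factor fj.
  have [w Hw] : dom H (act g (act (face j) z)) by apply/dom_act/IH.
  by exists w; rewrite /= act_comp.
have [x px xE] := fills_graph (bd n (v n z)) bdz.
have [|H' HH' H'E] := attach_cell px Nz; first by move=> m f /xE.
case: Nz; exists x; have GH' := extends_trans GH HH'.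
have /asboolP : R (exist _ H' GH') (exist _ H GH) by apply/Hmax/asboolP.
by apply; apply/H'E; right; exists (mono_id n); rewrite !act_id.
Qed.

End Extension.

(** * Contractible Kan complexes *)

Lemma mono_const_comp l m n (f : mono l m) (j : 'I_n.+1) :
  mono_comp (mono_const m j) f = mono_const l j.
Proof. by apply: mono_ext => i; rewrite mono_compE !mono_ofE. Qed.

Lemma point_eq n (x y : Delta 0 n) : x = y.
Proof. by apply: mono_ext => i; rewrite !ord1. Qed.

Lemma extend_smap (K L : sSet) (S : subsSet L) (u : smap S K) :
  (forall n y, fills (to_point K) (boundary n) y) ->
  exists h : smap L K, scomp h (sub_incl S) = u.
Proof.
move=> bd.
have uo n (z : S n) : to_point K n (u n z) = to_point L n (sval z) by [].
have [H GH totH] := extend_total (lift_of_sub uo) bd.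
have [//|h hH] := @smap_of_dom _ _ _ _ _ _ (sid L) H.
exists h; apply: smap_ext => n z /=; apply: graph_functional (hH _ _) _.
exact/GH/lift_of_subP.
Qed.

(** The homotopy extends the partial map on the two ends of the cylinder which is
    constant on one end and the identity on the other. *)
Lemma contractible_of_fills (K : sSet) :
  (forall n y, fills (to_point K) (boundary n) y) -> contractible_Kan_complex K.
Proof.
move=> bd; split; first by move=> n k _ u; apply: extend_smap.
(* A vertex of K comes from extending the map from the empty subset. *)
pose none := @SubsSet (Delta 0) (fun _ _ => False) (fun _ _ _ _ F => F).
have [g _] : exists g : smap (Delta 0) K, True.
  have u_nat m n (f : mono m n) (z : none n) :
    False_rect (K m) (svalP (act f z)) = act f (False_rect (K n) (svalP z)).
    by case: (svalP z).
  by have [g _] := @extend_smap K _ none (SMap u_nat) bd; exists g.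
exists g; split; last first.
  exists (to_point _); split=> n x; exact: point_eq.
pose gr n (z : sprod K (Delta 1) n) (w : K n) :=
  (z.2 = mono_const n ord0 /\ w = g n (mono_const n ord0)) \/
  (z.2 = mono_const n ord_max /\ w = z.1).
have gr_act m n (f : mono m n) z w : gr n z w -> gr m (act f z) (act f w).
  rewrite /gr /= => -[] [-> ->]; [left | by right; rewrite mono_const_comp].
  by rewrite mono_const_comp -smap_nat; split=> //; congr (g m _); apply: point_eq.
have gr_fun n z w w' : gr n z w -> gr n z w' -> w = w'.
  have const_neq : mono_const n ord0 <> mono_const n (ord_max : 'I_2).
    by move/(congr1 (fun f : mono _ _ => val (f ord0))); rewrite !mono_ofE.
  by case=> [] [E ->] [] [E' ->] //; case: const_neq; rewrite -E -E'.
have gr_over n z w : gr n z w -> to_point K n w = to_point (sprod K (Delta 1)) n z.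
  by [].
have [H GH totH] := extend_total (PartialLift gr_act gr_fun gr_over) bd.
have [//|h hH] := @smap_of_dom _ _ _ _ _ _ (sid _) H.
exists h; split=> n x; apply: graph_functional (hH _ _) _; apply: GH.
  by left.
by right.
Qed.

Lemma Kan_fills (K : sSet) n (k : 'I_n.+2) y :
  Kan_complex K -> fills (to_point K) (horn k) y.
Proof.
move=> KK u _; have [//|h hu] := KK _ k _ u; exists (h n.+1 (mono_id _)).
  exact: point_eq.
by move=> m z; rewrite -hu /= yoneda_id.
Qed.

Lemma homo_degen k : {homo (fun j => j - (k < j)) : i j / i <= j}.
Proof. by move=> i j; lia. Qed.

(** The degeneracy repeating the vertex [k]. *)
Definition degen n k : mono n.+1 n := mono_nat n.+1 n (homo_degen k).

Lemma degenE n k (j : 'I_n.+2) : k <= n -> degen n k j = j - (k < j) :> nat.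
Proof. by move=> kn; rewrite mono_natE; have := ltn_ord j; lia. Qed.

Lemma homo_step k : {homo (fun j : nat => k < j : nat) : i j / i <= j}.
Proof. by move=> i j; lia. Qed.

(** The [(n+1)]-simplex of Delta^1 that jumps after the vertex [k]. *)
Definition step n k : mono n.+1 1 := mono_nat n.+1 1 (homo_step k).

Lemma stepE n k (j : 'I_n.+2) : step n k j = (k < j) :> nat.
Proof. by rewrite mono_natE; lia. Qed.

(** Composing with the contraction [H] gives a map on the boundary times Delta^1,
    constant on the lower end, where it is extended constantly to Delta^n.  The
    prism is then filled downwards in [k] from [n] to [0] by the simplices
    (0,0), ..., (k,0), (k,1), ..., (n,1), each attached along its horn at the
    vertex (k,0); the restriction to the upper end of the prism is the filler. *)
Lemma fills_of_contractible (K : sSet) n y :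
  contractible_Kan_complex K -> fills (to_point K) (boundary n) y.
Proof.
move=> [KK [g [[H [H0 H1]] _]]] u _.
pose L := sprod (Delta n) (Delta 1).
pose gr m (z : L m) (w : K m) :=
  (exists Hz : Defs.sub_mem (boundary n) z.1, w = H m (u m (exist _ z.1 Hz), z.2)) \/
  (z.2 = mono_const m ord0 /\ w = g m (mono_const m ord0)).
have gr_act m l (f : mono m l) z w : gr l z w -> gr m (act f z) (act f w).
  rewrite /gr /= => -[[Hz ->]|[-> ->]]; [left | right].
    exists (boundary_act f Hz); rewrite -smap_nat /= -smap_nat.
    by congr (H m (u m _, _)); apply: sub_eq.
  by rewrite mono_const_comp -smap_nat; split=> //; congr (g m _); apply: point_eq.
have gr_fun m z w w' : gr m z w -> gr m z w' -> w = w'.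
  case=> [[Hz ->]|[E ->]] [[Hz' ->]|[E' ->]] //.
  - by congr (H m (u m _, _)); apply: sub_eq.
  - by rewrite E' H0 /=; congr (g m _); apply: point_eq.
  - by rewrite E H0 /=; congr (g m _); apply: point_eq.
have gr_over m z w : gr m z w -> to_point K m w = to_point L m z by [].
pose G0 := PartialLift gr_act gr_fun gr_over.
(* After [i] steps the domain consists of the simplices over the boundary and of
   those whose part on the upper end only involves vertices at least [n.+1 - i]. *)
have prism i : i <= n.+1 -> exists2 G, extends G0 G & forall m (z : L m),
    dom G z <-> Defs.sub_mem (boundary n) z.1 \/
                forall l, z.2 l = 1 :> nat -> n.+1 - i <= z.1 l.
  elim: i => [_|i IH lt_in].
    exists G0 => // m z; split.
      case=> w [[Hz _]|[E _]]; [by left | right => l].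
      by rewrite E mono_ofE.
    case=> [Hz|z2]; first by exists (H m (u m (exist _ z.1 Hz), z.2)); left; exists Hz.
    exists (g m (mono_const m ord0)); right; split=> //.
    apply: mono_ext => l; rewrite mono_ofE; apply/val_inj => /=.
    have := z2 l; have := ltn_ord (z.1 l); have := ltn_ord (z.2 l) => /=.
    by case: (val _) => [|[|]] // _ ?? ; lia.
  have [|G GG0 GE] := IH; first by lia.
  pose k := n - i; have lt_kn : k <= n by lia.
  have kE : n.+1 - i.+1 = k by lia.
  have kE1 : n.+1 - i = k.+1 by lia.
  rewrite kE; rewrite {}kE1 in GE.
  pose s : L n.+1 := (degen n k, step n k).
  pose kk : 'I_n.+2 := inord k; have kkE : kk = k :> nat by rewrite inordK; lia.
  have s1 m (z : mono m n.+1) l : (act z s).1 l = z l - (k < z l) :> nat.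
    by rewrite -degenE // -mono_compE.
  have s2 m (z : mono m n.+1) l : (act z s).2 l = (k < z l) :> nat.
    by rewrite -stepE -mono_compE.
  have sd m (z : Delta n.+1 m) : Defs.sub_mem (horn kk) z -> dom (pullback_lift G s) z.
    case=> j jk zj; have {}jk : j <> k :> nat by move=> E; apply: jk; apply: val_inj; rewrite /= kkE.
    have zj' l : z l <> j :> nat by move=> /val_inj/zj.
    have [|w Gw] := (GE m (act (z : mono _ _) s)).2; last by exists w.
    have [jk1|jk1] := eqVneq (j : nat) k.+1.
      by right=> l; rewrite s1 s2; have := zj' l; lia.
    left; exists (inord (j - (k < j))) => l /(congr1 val) /=.
    rewrite s1 inordK; last by have := ltn_ord j; lia.
    by have := zj' l; lia.
  have [x px xE] := fills_graph (@Kan_fills _ _ kk _ KK) sd.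
  have [||m f /xE//|G' GG' G'E] := attach_horn px (i := kk) (G := G).
  - move=> m f f'; cbv beta => E; apply: mono_ext => l; apply/val_inj => /=.
    have := s1 _ f l; have := s2 _ f l; rewrite E s1 s2; lia.
  - have faceK l : face kk l = l + (k <= l) :> nat by rewrite faceE /= /bump kkE; lia.
    move/GE => [[j fj]|].
      by apply: (fj j); apply/val_inj/(etrans (s1 _ _ _)); rewrite faceK /=; lia.
    by move/(_ (inord k)); rewrite s1 s2 faceK inordK; lia.
  exists G'; first exact: extends_trans GG0 GG'.
  move=> m z; split.
    case=> w /G'E[Gzw|[f [-> _]]].
      have /GE : dom G z by exists w.
      by case=> [|z2]; [left | right=> l /z2/ltnW].
    by right=> l; rewrite s1 s2; lia.
  have sub z' : dom G z' -> dom G' z' by case=> w /GG'; exists w.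
  case=> [|z2]; first by move=> Hz; apply/sub/GE; left.
  case: (EM (exists2 l, z.2 l = 1 :> nat & z.1 l = k :> nat)) => [[l0 z21 z1k]|Nl].
    (* The simplex [z] uses the vertex (k,1), so it is a face of [s], whose
       vertex with index [l] has coordinates adding up to [l]. *)
    have lt2 l : z.1 l + z.2 l < n.+2.
      by have := ltn_ord (z.1 l); have := ltn_ord (z.2 l); lia.
    have fM : {homo (fun l => inord (z.1 l + z.2 l) : 'I_n.+2) : i j / i <= j}.
      by move=> a b ab; rewrite !inordK // leq_add // mono_le.
    exists (act (mono_of fM) x); apply/G'E; right; exists (mono_of fM); split=> //.
    have bnd l : (z.2 l = 0 :> nat /\ z.1 l <= k) \/ (z.2 l = 1 :> nat /\ k <= z.1 l).
      have := ltn_ord (z.2 l); case zl: (val (z.2 l)) => [|[|//]] _; last by right; rewrite z2.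
      left; split=> //; rewrite -z1k mono_le // leqNgt; apply/negP => /ltnW/(mono_le z.2).
      by rewrite z21 zl.
    case: z {z2 z21 z1k sub} fM bnd lt2 => a b /= fM bnd lt2; congr (_, _).
      apply: mono_ext => l; apply/val_inj/esym/(etrans (s1 _ (mono_of fM) l)).
      by rewrite mono_ofE inordK //=; have := bnd l; lia.
    apply: mono_ext => l; apply/val_inj/esym/(etrans (s2 _ (mono_of fM) l)).
    by rewrite mono_ofE inordK //=; have := bnd l; lia.
  apply/sub/GE; right=> l zl; have := z2 l zl; rewrite leq_eqVlt => /orP[/eqP E|//].
  by case: Nl; exists l.
have [//|G GG0 GE] := prism n.+1.
have [w Gw] : dom G ((mono_id n, mono_const n ord_max) : L n).
  by apply/GE; right=> l; rewrite subnn.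
exists w => [|m z]; first exact: point_eq.
have := graph_act (sval z : mono m n) Gw; rewrite /= mono_const_comp mono_comp_idl => Gz.
apply: graph_functional _ Gz; apply: GG0; left; exists (svalP z).
by rewrite /= H1; congr (u m _); apply: sub_eq.
Qed.

(** * Exchanging a face for another *)

Section Pivot.
Variables (X Y : sSet) (p : smap X Y) (N : nat) (s : Y N.+1) (k e : 'I_N.+2).
Hypothesis k_neq_e : k != e.
Hypothesis horn_k : forall m (x : mono m.+1 N.+1) (i j : 'I_m.+2),
  injective x -> x i = k -> x j = e -> fills p (horn i) (act x s).

Let D : {set 'I_N.+2} := ~: [set k; e].
(** The vertices of [z] besides the pivot [k] and the vertex [e]. *)
Definition rest m (z : mono m N.+1) : {set 'I_N.+2} :=
  [set j in D | [exists i, z i == j]].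

Lemma restP m (z : mono m N.+1) j :
  reflect (j \in D /\ exists i, z i = j) (j \in rest z).
Proof.
rewrite [_ \in rest z]in_set; apply: (iffP andP) => -[-> H]; split=> //.
  by case/existsP: H => i /eqP <-; exists i.
by case: H => i zi; apply/existsP; exists i; apply/eqP.
Qed.

Lemma rest_sub m (z : mono m N.+1) : rest z \subset D.
Proof. by apply/subsetP => j /restP[]. Qed.

Variable G0 : partial_lift p (yoneda s).
Hypothesis G0E : forall m (z : Delta N.+1 m),
  dom G0 z <-> misses z e /\ exists2 j, j <> e & misses z j.

(** The simplices of Delta^(N+1) outside [G0] with a given set [T] of vertices in
    [D] are the faces of [k, e, T] that contain [e], and these are added by filling
    the horn at [k] of that simplex.  Induction on the family [F]: a member [T] of
    maximal cardinal is removed, so the remaining family is still closed under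
    subsets and contains all proper subsets of [T], which makes the horn
    available. *)
Lemma attach_family (F : {set {set 'I_N.+2}}) :
  (forall T, T \in F -> T \proper D) ->
  (forall T U : {set 'I_N.+2}, T \in F -> U \subset T -> U \in F) ->
  exists2 G, extends G0 G & forall m (z : Delta N.+1 m),
    dom G z <-> dom G0 z \/ rest z \in F.
Proof.
have [c] := ubnP #|F|; elim: c F => // c IH F cF FD Fdown.
have [F0|] := eqVneq F set0.
  exists G0 => // m z; rewrite F0 inE; split; first by left.
  by case.
case/set0Pn => T1 FT1.
have [T FT Tmax] := @arg_maxnP _ T1 (fun T => T \in F) (fun T => #|T|) FT1.
have [||U V /setD1P[UT FU] VU|G GG0 GE] := IH (F :\ T).
- by move: cF; rewrite (cardsD1 T F) FT; lia.
- by move=> U /setD1P[_ /FD].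
- rewrite !inE (Fdown _ _ FU VU) andbT; apply: contraNneq UT => VT.
  by rewrite VT in VU; rewrite eq_sym eqEcard VU; apply: Tmax.
have TD := FD _ FT.
have [|n [x [xI xE]]] := @subset_simplex _ (T :|: [set k; e]).
  by apply/set0Pn; exists k; rewrite !inE eqxx orbT.
have [i xi] : exists i, x i = k by apply/xE; rewrite !inE eqxx orbT.
have [j xj] : exists j, x j = e by apply/xE; rewrite !inE eqxx !orbT.
case: n => [|n] in x xI xE i xi j xj *.
  by move: k_neq_e; rewrite -xi -xj !ord1 eqxx.
have restx m (z : mono m N.+1) : (forall l, exists l', x l' = z l) -> rest z \subset T.
  move=> zx; apply/subsetP => a /restP[aD [l zl]].
  have [l' xl] := zx l; have : a \in T :|: [set k; e].
    by apply/xE; exists l'; rewrite xl.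
  by move: aD; rewrite !inE => /negPf ->; rewrite orbF.
have bd m (z : Delta n.+1 m) : Defs.sub_mem (horn i) z -> dom (pullback_lift G (x : Delta _ _)) z.
  case=> a ai zfa.
  have [|w Gw] := (GE m (mono_comp x z)).2; last by exists w.
  have xa l : mono_comp x z l <> x a by rewrite mono_compE => /xI/zfa.
  have xak : x a <> k by rewrite -xi => /xI.
  have rx : rest (mono_comp x z) \subset T.
    by apply: restx => l; exists (z l); rewrite mono_compE.
  have [xae|/eqP xae] := eqVneq (x a) e.
    left; apply/G0E; split; first by move=> l; rewrite -xae; apply: xa.
    have [_ /subsetPn [b bD bT]] := andP TD.
    exists b; first by move=> be; move: bD; rewrite be !inE eqxx orbT.
    move=> l zl; move/negP: bT; apply; apply: (subsetP rx).
    by apply/restP; split=> //; exists l.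
  right; rewrite in_setD1 (Fdown _ _ FT rx) andbT.
  have /setUP[xaT|] : x a \in T :|: [set k; e] by apply/xE; exists a.
    apply/eqP => rE; move: xaT; rewrite -rE => /restP[_ [l]]; exact: xa.
  by rewrite !inE => /orP[] /eqP.
have [y py yE] := fills_graph (horn_k xI xi xj) bd.
have facei l : x l <> k -> exists l', face i l' = l.
  move=> xlk; case: (unliftP i l) => [l'|] lE; last by rewrite lE xi in xlk.
  by exists l'; rewrite faceE.
have [||m f /yE//|H GH HE] := attach_horn (G := G) (x := x) py (i := i).
- move=> m f g; cbv beta => /= E; apply: mono_ext => l; apply: xI.
  by rewrite -!mono_compE E.
- move/GE; rewrite /= => -[/G0E[+ _]|].
    have [|l lj] := facei j; first by rewrite xj; apply/eqP; rewrite eq_sym.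
    by move/(_ l); rewrite mono_compE lj xj.
  rewrite in_setD1 => /andP[/eqP + _]; apply; apply/eqP.
  rewrite eqEsubset restx; last by move=> l; exists (face i l); rewrite [RHS]mono_compE.
  apply/subsetP => a aT; have aD := subsetP (proper_sub TD) _ aT; apply/restP; split=> //.
  have [l xl] : exists l, x l = a by apply/xE; rewrite inE aT.
  have [|l' ll] := facei l.
    by move=> xlk; move: aD; rewrite -xl xlk !inE eqxx.
  by exists l'; rewrite mono_compE ll.
exists H; first exact: extends_trans GG0 GH.
move=> m z; split.
  case=> w /HE[Gz|[f [-> _]]].
    have /GE : dom G z by exists w.
    by rewrite in_setD1 => -[|/andP[_]]; [left|right].
  right; apply: Fdown FT _; apply: restx => l; exists (f l).
  by rewrite /= mono_compE.
have sub : dom G z -> dom H z by case=> w /GH; exists w.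
case=> [G0z|Fz]; first by apply/sub/GE; left.
have [zT|zT] := eqVneq (rest z) T; last by apply/sub/GE; right; rewrite in_setD1 zT.
have [|g zE] := @mono_factor _ _ _ x z xI.
  move=> l; apply/xE; rewrite in_setU orbC -implyNb -in_setC; apply/implyP => zD.
  by rewrite -zT; apply/restP; split=> //; exists l.
by exists (act g y); apply/HE; right; exists g.
Qed.

End Pivot.

(** A partial lift on the boundary of the face opposite to [e] is extended to all
    simplices missing a vertex other than [k] and [e] by [attach_family].  This
    includes the boundary of the face opposite to [k]; attaching a filler of that
    boundary completes the horn at [e]. *)
Lemma pivot (X Y : sSet) (p : smap X Y) N (s : Y N.+1) (k e : 'I_N.+2) :
  k != e ->
  (forall m (x : mono m.+1 N.+1) (i j : 'I_m.+2),
     injective x -> x i = k -> x j = e -> fills p (horn i) (act x s)) ->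
  fills p (boundary N) (act (face k) s) -> fills p (horn e) s ->
  fills p (boundary N) (act (face e) s).
Proof.
move=> ke horn_k bd_k horn_e u pu.
pose gr m (z : Delta N.+1 m) (w : X m) :=
  exists2 t : boundary N m, z = mono_comp (face e) (sval t) & w = u m t.
have gr_act m l (f : mono m l) z w : gr l z w -> gr m (act f z) (act f w).
  case=> t -> ->; exists (act f t); first by rewrite /= mono_compA.
  by rewrite smap_nat.
have gr_fun m z w w' : gr m z w -> gr m z w' -> w = w'.
  case=> t -> -> [t' tt ->]; congr (u m _); apply: sub_eq.
  apply: mono_ext => i; apply: (@face_inj _ e).
  by rewrite -!mono_compE tt.
have gr_over m z w : gr m z w -> p m w = yoneda s m z.
  by case=> t -> ->; rewrite pu /= act_comp.
pose G0 := PartialLift gr_act gr_fun gr_over.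
have G0E m (z : Delta N.+1 m) :
    dom G0 z <-> misses z e /\ exists2 j, j <> e & misses z j.
  split=> [[w [[t [j tj]] -> _]]|[ze [j je zj]]] /=.
    split=> [l|]; first by rewrite mono_compE; apply: face_misses.
    exists (lift e j); first by apply/eqP; rewrite eq_sym neq_lift.
    by move=> l; rewrite mono_compE faceE => /lift_inj; apply: tj.
  have [t zt] := face_factor ze.
  have bt : Defs.sub_mem (boundary N) (t : Delta N m).
    case: (unliftP e j) => [j' jE|//]; exists j' => l tl.
    by apply: (zj l); rewrite zt mono_compE faceE tl.
  by exists (u m (exist _ _ bt)); exists (exist _ _ bt).
pose D : {set 'I_N.+2} := ~: [set k; e].
have [||G GG0 GE] := attach_family ke horn_k G0E (F := [set T : {set 'I_N.+2} | T \proper D]).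
- by move=> T; rewrite inE.
- by move=> T U; rewrite !inE => TD UT; apply: sub_proper_trans UT TD.
have miss_rest m (z : Delta N.+1 m) j : j <> k -> j <> e -> misses z j -> dom G z.
  move=> jk je zj; apply/GE; right; rewrite inE properE rest_sub /=.
  apply/subsetPn; exists j; first by rewrite !inE negb_or; apply/andP; split; apply/eqP.
  by apply/negP => /restP[_ [l]]; apply: zj.
have bdk m (z : Delta N m) : Defs.sub_mem (boundary N) z ->
    dom (pullback_lift G (face k : Delta N.+1 N)) z.
  case=> j zj.
  have zk : misses (mono_comp (face k) z : Delta N.+1 m) k.
    by move=> l; rewrite mono_compE; apply: face_misses.
  have zj' : misses (mono_comp (face k) z : Delta N.+1 m) (lift k j).
    by move=> l; rewrite mono_compE faceE => /lift_inj; apply: zj.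
  have jk : lift k j <> k by apply/eqP; rewrite eq_sym neq_lift.
  suff [w Gw] : dom G (mono_comp (face k) z : Delta N.+1 m) by exists w.
  have [je|/eqP je] := eqVneq (lift k j) e; last exact: miss_rest jk je zj'.
  by apply/GE; left; apply/G0E; rewrite -je; split=> //; exists k => // /esym.
have [x px xE] := fills_graph bd_k bdk.
have [|m f /xE//|H GH HE] := attach_cell (G := G) (x := face k : Delta N.+1 N) px.
  move/GE => [/G0E[+ _]|].
    case: (unliftP k e) ke => [e' ->|->]; last by rewrite eqxx.
    by move=> _ /(_ e'); rewrite faceE.
  rewrite inE properE rest_sub /= => /subsetPn[j jD]; case/negP.
  apply/restP; split=> //.
  case: (unliftP k j) jD => [j' ->|->]; last by rewrite !inE eqxx.
  by exists j'; rewrite faceE.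
have he m (z : Delta N.+1 m) : Defs.sub_mem (horn e) z -> dom H z.
  case=> j je zj; have [jk|/eqP jk] := eqVneq j k.
    have [g ->] : exists g, z = mono_comp (face k) g by apply: face_factor; rewrite -jk.
    by exists (act g x); apply/HE; right; exists g.
  by have [w /GH] := miss_rest _ _ _ jk je zj; exists w.
have [y py yE] := fills_graph horn_e he.
exists (act (face e) y); first by rewrite smap_nat py.
move=> m z; have G0z : G0 m (mono_comp (face e) (sval z)) (u m z) by exists z.
apply: graph_functional (GH _ _ _ (GG0 _ _ _ G0z)) _.
rewrite -act_comp; apply: yE; have /G0E[ze [j je zj]] : dom G0 (mono_comp (face e) (sval z)).
  by exists (u m z).
by exists j.
Qed.

(** * Zigzags in a bifibration *)

Lemma fiber_fills (X Y : sSet) (p : smap X Y) (b : Y 0) n (S : subsSet (Delta n)) y :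
  fills (to_point (fiber p b)) S y <-> fills p S (act (mono_const n ord0) b).
Proof.
split=> fS u pu.
  have uF m (z : S m) : p m (u m z) = act (mono_const m ord0) b.
    by rewrite pu -act_comp mono_const_comp.
  pose w m (z : S m) : fiber p b m := exist _ (u m z) (uF m z).
  have w_nat m l (f : mono m l) (z : S l) : w m (act f z) = act f (w l z).
    by apply: sub_eq; rewrite /= smap_nat.
  have [m z|x _ xE] := fS (SMap w_nat); first exact: point_eq.
  by exists (sval x) => [|m z]; [exact: svalP x | have /(congr1 sval) := xE m z].
have [m z|x px xE] := fS (scomp (sub_incl (fiber p b)) u).
  by rewrite -act_comp mono_const_comp; exact: svalP (u m z).
exists (exist _ x px) => [|m z]; first exact: point_eq.
by apply: sub_eq; apply: xE.
Qed.

Lemma degenerate_const (B : sSet) n (b : B n) (f : mono 1 n) :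
  f ord0 = f ord_max :> nat -> degenerate (act f b).
Proof.
move=> /val_inj f01; exists 0, (mono_const 1 ord0), (act (mono_const 0 (f ord0)) b).
split=> //; rewrite -act_comp; congr (act _ b); apply: mono_ext => i.
rewrite mono_compE !mono_ofE; case: i => [[|[|//]]] Hi.
  by congr (f _); apply: val_inj.
by rewrite f01; congr (f _); apply: val_inj.
Qed.

Lemma faceK n (i : nat) (j : 'I_n.+1) : i < n.+2 ->
  face (inord i) j = j + (i <= j) :> nat.
Proof. by move=> lt_i; rewrite faceE /= /bump inordK //; lia. Qed.

Lemma degen_face_id n k i : k <= n -> (i = k \/ i = k.+1) ->
  mono_comp (degen n k) (face (inord i)) = mono_id n.
Proof.
move=> lt_k ik; apply: mono_nat_ext => j.
rewrite mono_compE mono_idE degenE // faceK; lia.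
Qed.

Section Bifibration.
Variables (A B X : sSet) (p : smap X (sprod A B)).
Hypothesis hp : bifibration p.

Lemma fills_inner n (i : 'I_n.+1) y : 0 < i < n -> fills p (horn i) y.
Proof.
move=> lt_i; have [inner _ _] := hp; rewrite -[y]act_id.
by apply/(filler_fills p _ (yoneda y)) => u; apply: inner.
Qed.

Lemma fills_left n (y : sprod A B n.+1) :
  degenerate (act (first_edge n) y.2) -> fills p (horn (ord0 : 'I_n.+2)) y.
Proof.
move=> dy; have [_ left_horn _] := hp; rewrite -[y]act_id.
by apply/(filler_fills p _ (yoneda y)) => u pu; apply: left_horn.
Qed.

Lemma fills_right n (y : sprod A B n.+1) :
  degenerate (act (last_edge n) y.1) -> fills p (horn (ord_max : 'I_n.+2)) y.
Proof.
move=> dy; have [_ _ right_horn] := hp; rewrite -[y]act_id.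
by apply/(filler_fills p _ (yoneda y)) => u pu; apply: right_horn.
Qed.

Section Zigzag.
Variables (n k : nat) (lt_kn : k < n) (a : A n) (b : B n).

(* The vertices of [s] are those of [(a, b)] together with [e], which has the first
   coordinate of the vertex [k.+1] and the second coordinate of the vertex [k]. *)
Let s : sprod A B n.+1 := (act (degen n k.+1) a, act (degen n k) b).
Let e : 'I_n.+2 := inord k.+1.

Lemma face_zigzag : act (face e) s = (a, b).
Proof. by rewrite /s /= -!act_comp !degen_face_id ?act_id //; lia. Qed.

(** The pivot is the vertex [k], which precedes [e]; their edge is degenerate in
    [B]. *)
Lemma raise_vertex :
  fills p (boundary n)
    ((act (mono_comp (degen n k.+1) (face (inord k))) a, b) : sprod A B n) ->
  fills p (boundary n) ((a, b) : sprod A B n).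
Proof.
move=> bd; rewrite -face_zigzag; apply: (@pivot _ _ _ _ _ (inord k)).
- by rewrite -val_eqE /= !inordK; lia.
- move=> m x i j xI xi xj.
  have xi' : x i = k :> nat by rewrite xi inordK; lia.
  have xj' : x j = k.+1 :> nat by rewrite xj inordK; lia.
  have ij : i < j.
    by rewrite ltnNge; apply/negP => /(mono_le x); rewrite xi' xj'; lia.
  have [i0|i0] := posnP i; last by apply: fills_inner; have := ltn_ord j; lia.
  have iE : i = ord0 by apply: val_inj.
  rewrite iE in xi' ij *; apply: fills_left; rewrite /= -!act_comp.
  apply: degenerate_const; rewrite !mono_compE !degenE; try lia.
  have -> : first_edge m ord0 = ord0 by rewrite mono_ofE; apply: val_inj; rewrite /= inordK.
  have : x ord0 <= x (first_edge m ord_max) by exact: mono_le.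
  have : x (first_edge m ord_max) <= x j.
    by apply: mono_le; rewrite mono_ofE inordK.
  lia.
- by rewrite /s /= -!act_comp (@degen_face_id n k) ?act_id //; [lia | left].
- by apply: fills_inner; rewrite inordK; lia.
Qed.

(** The pivot is the vertex [k.+2], which follows [e]; their edge is degenerate
    in [A]. *)
Lemma lower_vertex :
  fills p (boundary n)
    ((a, act (mono_comp (degen n k) (face (inord k.+2))) b) : sprod A B n) ->
  fills p (boundary n) ((a, b) : sprod A B n).
Proof.
move=> bd; rewrite -face_zigzag; apply: (@pivot _ _ _ _ _ (inord k.+2)).
- by rewrite -val_eqE /= !inordK; lia.
- move=> m x i j xI xi xj.
  have xi' : x i = k.+2 :> nat by rewrite xi inordK; lia.
  have xj' : x j = k.+1 :> nat by rewrite xj inordK; lia.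
  have ij : j < i.
    by rewrite ltnNge; apply/negP => /(mono_le x); rewrite xi' xj'; lia.
  have [im|im] := eqVneq i ord_max; last first.
    apply: fills_inner; have := ltn_ord i; move: im; rewrite -val_eqE /=; lia.
  rewrite im /= in xi' ij *; apply: fills_right; rewrite /= -!act_comp.
  apply: degenerate_const; rewrite !mono_compE !degenE; try lia.
  have -> : last_edge m ord_max = ord_max.
    by rewrite mono_ofE; apply: val_inj; rewrite /= inordK ?addn1.
  have : x (last_edge m ord0) <= x ord_max by apply: mono_le; rewrite -ltnS.
  have : x j <= x (last_edge m ord0).
    by apply: mono_le; rewrite mono_ofE inordK /= addn0; lia.
  lia.
- by rewrite /s /= -!act_comp (@degen_face_id n k.+1) ?act_id //; right.
- by apply: fills_inner; rewrite inordK; lia.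
Qed.

End Zigzag.

Lemma homo_up n j : {homo (fun i => if i < j then i else i + n) : i k / i <= k}.
Proof. by move=> i k ik; do 2! case: ifP => /=; lia. Qed.

(** The value is [n] from [j] on, by the cut-off in [mono_nat]. *)
Definition up n j : mono n n := mono_nat n n (homo_up n j).

Lemma homo_down j : {homo (fun i => if i <= j then 0 else i) : i k / i <= k}.
Proof. by move=> i k ik; do 2! case: ifP => /=; lia. Qed.

Definition down n j : mono n n := mono_nat n n (homo_down j).

(** The vertices of [a] are raised to the last one in the order n-1, ..., 0. *)
Lemma fills_fst_last n (a : A n) (b : B n) :
  fills p (boundary n) ((act (mono_const n ord_max) a, b) : sprod A B n) ->
  fills p (boundary n) ((a, b) : sprod A B n).
Proof.
move=> bd.
have upj j : j <= n -> fills p (boundary n) ((act (up n j) a, b) : sprod A B n).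
  elim: j => [_|j IH lt_jn].
    suff -> : up n 0 = mono_const n ord_max by [].
    by apply: mono_nat_ext => i; rewrite mono_natE mono_ofE /=; lia.
  apply: (raise_vertex lt_jn); rewrite -act_comp.
  suff -> : mono_comp (up n j.+1) (mono_comp (degen n j.+1) (face (inord j))) = up n j.
    by apply: IH; lia.
  apply: mono_nat_ext => i.
  rewrite !mono_compE !mono_natE faceK; last lia.
  have := ltn_ord i; do 2! case: ifP => /=; lia.
have := upj n (leqnn n); suff -> : up n n = mono_id n by rewrite act_id.
apply: mono_nat_ext => i.
by rewrite mono_natE mono_idE; have := ltn_ord i; case: ifP => /=; lia.
Qed.

(** The vertices of [b] are lowered to the first one in the order 1, ..., n. *)
Lemma fills_snd_first n (a : A n) (b : B n) :
  fills p (boundary n) ((a, act (mono_const n ord0) b) : sprod A B n) ->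
  fills p (boundary n) ((a, b) : sprod A B n).
Proof.
move=> bd.
have downj j : j <= n ->
    fills p (boundary n) ((a, act (down n (n - j)) b) : sprod A B n).
  elim: j => [_|j IH lt_jn].
    suff -> : down n (n - 0) = mono_const n ord0 by [].
    apply: mono_nat_ext => i; rewrite mono_natE mono_ofE /=.
    by have := ltn_ord i; case: ifP => /=; lia.
  have lt_kn : n - j.+1 < n by lia.
  apply: (lower_vertex lt_kn); rewrite -act_comp.
  suff -> : mono_comp (down n (n - j.+1))
      (mono_comp (degen n (n - j.+1)) (face (inord (n - j.+1).+2))) = down n (n - j).
    by apply: IH; lia.
  apply: mono_nat_ext => i.
  rewrite !mono_compE !mono_natE faceK; last lia.
  have := ltn_ord i; do 2! case: ifP => /=; lia.
have := downj n (leqnn n); suff -> : down n (n - n) = mono_id n by rewrite act_id.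
apply: mono_nat_ext => i.
by rewrite mono_natE mono_idE; have := ltn_ord i; case: ifP => /=; lia.
Qed.

End Bifibration.

Lemma trivial_Kan_fills (X Y : sSet) (p : smap X Y) :
  trivial_Kan_fibration p <-> forall n y, fills p (boundary n) y.
Proof.
split=> [tp n y|bd n u f]; last exact: (filler_fills p _ f).2 (bd n _) u.
by rewrite -[y]act_id; apply/(filler_fills p _ (yoneda y)) => u; apply: tp.
Qed.

(** * The theorem *)

Theorem mainTheorem5 (A B X : sSet) (p : smap X (sprod A B))
    (hp : bifibration p) :
  trivial_Kan_fibration p <->
  (forall (a : A 0) (b : B 0),
     contractible_Kan_complex (fiber p (a, b))).
Proof.
rewrite trivial_Kan_fills; split=> [bd a b|ctr n [a b]].
  by apply: contractible_of_fills => n y; apply/fiber_fills.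
apply: fills_fst_last => //; apply: fills_snd_first => //.
rewrite -(@mono_const_comp n 0 n (mono_const n ord0) ord_max).
rewrite -(@mono_const_comp n 0 n (mono_const n ord0) ord0) !act_comp.
apply: (fiber_fills p (act (mono_const 0 ord_max) a, act (mono_const 0 ord0) b)
         (boundary n) (mono_const n ord0)).1.
exact: fills_of_contractible (ctr _ _).
Qed.
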